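(* Let $\Omega\subset\mathbb{R}^N$ be a smooth bounded domain and $0<\alpha<1$. Assume that there exist a subsolution $u_0$ and a supersolution $u^0$ of the problem $$-\Delta u=\frac{1}{u^\alpha}\ \text{ in }\Omega,\qquad u=0\ \text{ on }\partial\Omega,$$ such that $u_0\le u^0$, and constants $c_1,c_2$ such that $0<c_1 d(x)\le u_0(x)\le u^0(x)\le c_2 d(x)$ in $\Omega$. If $u$ and $v$ are two solutions of the problem such that $u_0\le u\le u^0$ and $u_0\le v\le u^0$, then $u\equiv v$.
   Context: $d(x)=\mathrm{dist}(x,\partial\Omega)$. Functions $u_0,u^0\in H^1_0(\Omega)\cap L^\infty(\Omega)$ are called respectively a subsolution and a supersolution of the problem if $$\int_\Omega\nabla u_0\cdot\nabla v\,dx-\int_\Omega u_0^{-\alpha}v\,dx\le 0\le\int_\Omega\nabla u^0\cdot\nabla v\,dx-\int_\Omega (u^0)^{-\alpha}v\,dx\quad\text{for all }v\in H^1_0(\Omega),\ v\ge 0.$$ A (weak) solution $u$ with $u_0\le u\le u^0$ is a function $u\in H^1_0(\Omega)$ with $\int_\Omega\nabla u\cdot\nabla v\,dx=\int_\Omega u^{-\alpha}v\,dx$ for all $v\in H^1_0(\Omega)$. All inequalities between functions are a.e. in $\Omega$. *)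

(* Defs.v *)
From HB Require Import structures.
From mathcomp Require Export all_boot all_order all_algebra.
From mathcomp Require Export all_classical all_reals all_analysis.

Set Implicit Arguments.
Unset Strict Implicit.
Unset Printing Implicit Defensive.

Import Order.TTheory GRing.Theory Num.Theory.
Export numFieldNormedType.Exports.

Local Open Scope classical_set_scope.
Local Open Scope ring_scope.

(* R^N is 'rV[R]_N, with the library's topology, and the sigma-algebra
   generated by the coordinates (which is the Borel one). Measurable functions
   are thus Borel functions; this is no restriction since all statements about
   them are modulo Lebesgue-null sets. *)
Definition measure_rV_display : measure_display -> measure_display.
Proof. exact. Qed.

Section measurable_rV.
Context {d : measure_display} {T : measurableType d} (n : nat).

Let coor (i : 'I_n) (x : 'rV[T]_n) : T := x ord0 i.

Let rV_set0 : g_sigma_preimage coor set0.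
Proof. exact: sigma_algebra0. Qed.

Let rV_setC A : g_sigma_preimage coor A -> g_sigma_preimage coor (~` A).
Proof. exact: sigma_algebraC. Qed.

Let rV_bigcup (F : (set 'rV[T]_n)^nat) :
  (forall i, g_sigma_preimage coor (F i)) ->
  g_sigma_preimage coor (\bigcup_i (F i)).
Proof. exact: sigma_algebra_bigcup. Qed.

HB.instance Definition _ := @isMeasurable.Build (measure_rV_display d)
  'rV[T]_n (g_sigma_preimage coor) rV_set0 rV_setC rV_bigcup.

Lemma measurable_coor (i : 'I_n) :
  measurable_fun [set: 'rV[T]_n] (fun x : 'rV[T]_n => x ord0 i).
Proof.
move=> _ Y mY; rewrite setTI; apply: sub_sigma_algebra => /=.
rewrite (bigD1 i)//=; left; exists Y => //; by rewrite setTI.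
Qed.

Lemma measurable_fun_rV d' (S : measurableType d') (f : S -> 'rV[T]_n) :
  (forall i, measurable_fun [set: S] (fun x => f x ord0 i)) ->
  measurable_fun [set: S] f.
Proof.
move=> mf; pose G := \big[setU/set0]_(i < n)
  preimage_set_system [set: 'rV[T]_n] (coor i) measurable.
apply: (@measurability _ _ _ _ setT f G) => //.
move=> _ [C GC <-]; move: GC; rewrite /G; elim/big_ind: _ => //.
- by move=> X Y HX HY [/HX|/HY].
- by move=> i _ [B mB <-]; rewrite setTI; exact: mf.
Qed.

End measurable_rV.

Section lebesgue_rV.
Context {R : realType}.
Implicit Types n : nat.

Definition cons_rV n (p : (measurableTypeR R * 'rV[R]_n)%type) : 'rV[R]_n.+1 :=
  row_mx (p.1%:M : 'M[R]_(1, 1)) p.2.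

Lemma cons_rV0 n p : @cons_rV n p ord0 ord0 = p.1.
Proof.
rewrite /cons_rV mxE; case: splitP => // j _.
by rewrite mxE !ord1 eqxx mulr1n.
Qed.

Lemma cons_rVS n p i : @cons_rV n p ord0 (lift ord0 i) = p.2 ord0 i.
Proof.
rewrite /cons_rV mxE; case: splitP => [j|j].
  by rewrite /= /bump add1n ord1.
by rewrite lift0 add1n => -[ij]; congr (_ _ _); exact/val_inj.
Qed.

Lemma measurable_cons_rV n : measurable_fun setT (@cons_rV n).
Proof.
apply: measurable_fun_rV => i; case: (unliftP ord0 i) => [j|] ->.
- rewrite (_ : (fun p => _) = (fun p => @fun_of_matrix R 1 n p.2 ord0 j)); last first.
    by apply/funext => p; rewrite cons_rVS.
  exact: measurableT_comp (measurable_coor j) measurable_snd.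
- rewrite (_ : (fun p => _) = fst); last first.
    by apply/funext => p; rewrite cons_rV0.
  exact: measurable_fst.
Qed.

Definition product_cons n (mu : set 'rV[R]_n -> \bar R) :
  set 'rV[R]_n.+1 -> \bar R :=
  pushforward (product_measure1 (@lebesgue_measure R) mu) (@cons_rV n).

Section product_cons.
Variables (n : nat) (mu : {sigma_finite_measure set 'rV[R]_n -> \bar R}).

Let pi : {measure set (measurableTypeR R * 'rV[R]_n)%type -> \bar R} :=
  [the measure _ _ of product_measure1 (@lebesgue_measure R) mu].

Let pc0 : product_cons mu set0 = 0%E.
Proof. by rewrite /product_cons /pushforward preimage_set0 (measure0 pi). Qed.

Let pc_ge0 A : (0 <= product_cons mu A)%E.
Proof. exact: (measure_ge0 pi). Qed.

Let pc_sigma_additive : semi_sigma_additive (product_cons mu).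
Proof.
have mc A : measurable A -> measurable (@cons_rV n @^-1` A).
  by move=> mA; rewrite -[X in measurable X]setTI; exact: measurable_cons_rV.
move=> F mF tF mUF; rewrite /product_cons /pushforward preimage_bigcup.
apply: (@measure_semi_sigma_additive _ _ _ pi (fun k => @cons_rV n @^-1` F k)).
- by move=> k; exact: mc.
- apply/trivIsetP => /= i j _ _ ij; rewrite -preimage_setI.
  by move/trivIsetP : tF => /(_ _ _ _ _ ij) ->//; rewrite preimage_set0.
- by rewrite -preimage_bigcup; exact: mc.
Qed.

HB.instance Definition _ := isMeasure.Build _ _ _ (product_cons mu)
  pc0 pc_ge0 pc_sigma_additive.

Let pc_sigma_finite : sigma_finite setT (product_cons mu).
Proof.
have /sigma_finiteP[F [TF ndF Foo]] := sigma_finiteT (@lebesgue_measure R).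
have /sigma_finiteP[G [TG ndG Goo]] := sigma_finiteT mu.
have mu1 : measurable_fun setT (fun x : 'rV[R]_n.+1 =>
    ((x ord0 ord0 : measurableTypeR R), \row_i x ord0 (lift ord0 i))).
  apply/measurable_fun_pairP; split => /=; first exact: measurable_coor.
  apply: measurable_fun_rV => i /=.
  rewrite (_ : (fun x => _) = (fun x : 'rV[R]_n.+1 => x ord0 (lift ord0 i))).
    exact: measurable_coor.
  by apply/funext => x; rewrite mxE.
have cK p : (cons_rV p ord0 ord0, \row_i cons_rV p ord0 (lift ord0 i)) = p.
  case: p => t y; rewrite cons_rV0 /=; congr (_, _).
  by apply/rowP => i; rewrite mxE cons_rVS.
exists (fun k => (fun x : 'rV[R]_n.+1 =>
  ((x ord0 ord0 : measurableTypeR R), \row_i x ord0 (lift ord0 i))) @^-1`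
    (F k `*` G k)).
  rewrite -preimage_bigcup (_ : \bigcup_k _ = setT) ?preimage_setT//.
  rewrite -setXTT TF TG; apply/seteqP; split => [[x y] [k _ [/= ? ?]]|[x y]].
    by split; exists k.
  move=> [/= [k _ Fkx] [l _ Gly]]; exists (maxn k l) => //; split.
  - by move: x Fkx; exact/subsetPset/ndF/leq_maxl.
  - by move: y Gly; exact/subsetPset/ndG/leq_maxr.
move=> k; have [? ?] := Foo k; have [? ?] := Goo k; split.
  by rewrite -[X in measurable X]setTI; apply: mu1 => //; exact: measurableX.
rewrite /product_cons /pushforward -comp_preimage.
rewrite (_ : _ \o _ = id) ?preimage_id; last by apply/funext => p /=; rewrite cK.
by rewrite product_measure1E// lte_mul_pinfty// ge0_fin_numE.
Qed.

HB.instance Definition _ := Measure_isSigmaFinite.Build _ _ _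
  (product_cons mu) pc_sigma_finite.

End product_cons.

Fixpoint lebesgue_rV n : {sigma_finite_measure set 'rV[R]_n -> \bar R} :=
  match n with
  | 0 => [the sigma_finite_measure _ _ of dirac (0 : 'rV[R]_0)]
  | m.+1 => [the sigma_finite_measure _ _ of product_cons (lebesgue_rV m)]
  end.

Let measurable_box n (A : 'I_n -> set (measurableTypeR R)) :
  (forall i, measurable (A i)) ->
  measurable [set x : 'rV[R]_n | forall i, A i (x ord0 i)].
Proof.
move=> mA; rewrite (_ : mkset _ = \big[setI/setT]_(i < n)
    ((fun x : 'rV[R]_n => x ord0 i) @^-1` A i)).
  apply: bigsetI_measurable => i _; rewrite -[X in measurable X]setTI.
  by apply: measurable_coor => //; exact: mA.
apply/seteqP; split => x; last first.
  by rewrite -bigcap_seq_cond => Ax i; apply: Ax; rewrite /= mem_index_enum.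
by move=> Ax; rewrite -bigcap_seq_cond => i _; exact: Ax.
Qed.

Lemma lebesgue_rV_box n (A : 'I_n -> set (measurableTypeR R)) :
  (forall i, measurable (A i)) ->
  lebesgue_rV n [set x : 'rV[R]_n | forall i, A i (x ord0 i)] =
  (\prod_(i < n) lebesgue_measure (A i))%E.
Proof.
elim: n A => [|n IH] A mA.
  by rewrite big_ord0 /= diracE mem_set// => -[].
rewrite big_ord_recl -IH; last by move=> i; exact: mA.
rewrite -product_measure1E//; last by exact: (measurable_box (fun i => mA (lift ord0 i))).
rewrite [LHS]/= /product_cons /pushforward.
rewrite (_ : _ @^-1` _ = A ord0 `*`
  [set y : 'rV[R]_n | forall i, A (lift ord0 i) (y ord0 i)])//.
apply/seteqP; split => [p /= Ap|p /= [A0 AS] i].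
  split=> [|i]; first by rewrite -(cons_rV0 p); exact: Ap.
  by rewrite -cons_rVS; exact: Ap.
by case: (unliftP ord0 i) => [j|] ->; rewrite ?cons_rVS ?cons_rV0.
Qed.

End lebesgue_rV.

Section euclidean.
Context {R : realType} {N : nat}.
Implicit Types (x y : 'rV[R]_N) (A Omega : set 'rV[R]_N).

(* The library's norm on 'rV[R]_N is the sup norm. *)
Definition enorm x : R := Num.sqrt (\sum_(i < N) x ord0 i ^+ 2).

Definition boundary A : set 'rV[R]_N := closure A `&` closure (~` A).

(* inf is the infimum in R; the boundary of a nonempty bounded open set is
   nonempty when N > 0. *)
Definition dist_boundary Omega x : R :=
  inf [set enorm (x - y) | y in boundary Omega].

Definition partial (i : 'I_N) (f : 'rV[R]_N -> R) : 'rV[R]_N -> R :=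
  fun x => 'D_(delta_mx ord0 i : 'rV[R]_N) f x.

Definition iter_partial (s : seq 'I_N) (f : 'rV[R]_N -> R) :
  'rV[R]_N -> R := foldr partial f s.

Definition smooth (f : 'rV[R]_N -> R) : Prop :=
  forall s : seq 'I_N, continuous (iter_partial s f) /\
    forall (i : 'I_N) x,
      derivable (iter_partial s f) x (delta_mx ord0 i : 'rV[R]_N).

Definition domain Omega : Prop :=
  [/\ Omega !=set0, open Omega & connected Omega].

Definition test_function Omega (phi : 'rV[R]_N -> R) : Prop :=
  [/\ smooth phi, compact (closure [set x | phi x != 0]) &
      closure [set x | phi x != 0] `<=` Omega].

End euclidean.

(* Near each boundary point, Omega is the region strictly on one side
   of the graph of a smooth function of N - 1 of the coordinates
   (col' i x is x with its i-th coordinate removed, s chooses the side). *)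
Definition smooth_boundary {R : realType} {N : nat} (Omega : set 'rV[R]_N) :=
  forall x0, boundary Omega x0 ->
  exists r : R, exists i : 'I_N, exists s : bool,
  exists gamma : 'rV[R]_N.-1 -> R,
  [/\ 0 < r, smooth gamma &
      forall x, enorm (x - x0) < r ->
        (Omega x <-> gamma (col' i x) < (-1) ^+ s * x ord0 i)].

Definition smooth_bounded_domain {R : realType} {N : nat}
    (Omega : set 'rV[R]_N) : Prop :=
  [/\ domain Omega, bounded_set Omega & smooth_boundary Omega].

Section sobolev.
Context {R : realType} {N : nat} (Omega : set 'rV[R]_N).
Implicit Types (u v f : 'rV[R]_N -> R) (g : 'rV[R]_N -> 'rV[R]_N).

Let mu := @lebesgue_rV R N.

Definition ae_in (P : 'rV[R]_N -> Prop) : Prop :=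
  {ae mu, forall x, Omega x -> P x}.

Definition L2 f : Prop :=
  measurable_fun Omega f /\ (\int[mu]_(x in Omega) ((f x) ^+ 2)%:E < +oo)%E.

Definition Linfty f : Prop :=
  measurable_fun Omega f /\ exists M : R, ae_in (fun x => `|f x| <= M).

Definition weak_gradient u g : Prop :=
  forall phi, test_function Omega phi -> forall i : 'I_N,
    (\int[mu]_(x in Omega) (u x * partial i phi x)%:E =
     - \int[mu]_(x in Omega) (g x ord0 i * phi x)%:E)%E.

(* u belongs to H^1(Omega), with weak gradient g. *)
Definition H1_gradient u g : Prop :=
  [/\ L2 u, forall i : 'I_N, L2 (fun x => g x ord0 i) & weak_gradient u g].

(* H^1_0(Omega) is the closure of the test functions in H^1(Omega); the
   integral is the square of the H^1 norm of phi - u. *)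
Definition H10_gradient u g : Prop :=
  H1_gradient u g /\
  forall e : R, 0 < e -> exists2 phi, test_function Omega phi &
    (\int[mu]_(x in Omega) ((phi x - u x) ^+ 2 +
       \sum_(i < N) (partial i phi x - g x ord0 i) ^+ 2)%:E < e%:E)%E.

Definition H10 u : Prop := exists g, H10_gradient u g.

(* A chosen representative of the weak gradient of u, which is unique up to
   null sets; used only for u in H^1_0(Omega). *)
Definition grad u : 'rV[R]_N -> 'rV[R]_N := xget (fun=> 0) (H10_gradient u).

Definition dirichlet_form u v : \bar R :=
  (\int[mu]_(x in Omega) (\sum_(i < N) grad u x ord0 i * grad v x ord0 i)%:E)%E.

(* This and dirichlet_form are integrals in \bar R; an equality between the two
   contains the integrability of u^(-alpha) v, dirichlet_form being finite. *)
Definition singular_term (alpha : R) u v : \bar R :=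
  (\int[mu]_(x in Omega) (u x `^ (- alpha) * v x)%:E)%E.

Definition subsolution (alpha : R) u : Prop :=
  [/\ H10 u, Linfty u & forall v, H10 v -> ae_in (fun x => 0 <= v x) ->
    (dirichlet_form u v - singular_term alpha u v <= 0)%E].

Definition supersolution (alpha : R) u : Prop :=
  [/\ H10 u, Linfty u & forall v, H10 v -> ae_in (fun x => 0 <= v x) ->
    (0 <= dirichlet_form u v - singular_term alpha u v)%E].

Definition weak_solution (alpha : R) u : Prop :=
  H10 u /\
  forall v, H10 v -> dirichlet_form u v = singular_term alpha u v.

End sobolev.

(* Main.v *)
Require Import Defs.
From mathcomp Require Import ring lra measurable_realfun.

Set Implicit Arguments.
Unset Strict Implicit.
Unset Printing Implicit Defensive.

Local Open Scope classical_set_scope.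
Local Open Scope ring_scope.

Import Order.TTheory GRing.Theory Num.Theory.

(** The map s |-> s^(-alpha) is strictly decreasing on the positive reals.
    Write D(f, g) for the integral over Omega of grad f . grad g. Testing the
    equation of u with u and with v, and likewise the equation of v, gives
      (D(u, u) - D(u, v)) - (D(v, u) - D(v, v))
        = int_Omega (u^(-alpha) - v^(-alpha)) (u - v).
    The left-hand side is the integral of |grad u - grad v|^2, hence is
    nonnegative, whereas the integrand on the right is nonpositive almost
    everywhere, since u and v are positive almost everywhere. This integrand
    therefore vanishes almost everywhere, and as it is negative wherever u and v
    differ, u = v almost everywhere ([positive_weak_solution_unique]).

    Using u and v separately as test functions, rather than u - v, makes the
    linearity of the chosen gradient unnecessary. Subtracting the
    four identities requires each singular integral to be finite: its integrand
    is nonnegative almost everywhere and its value is a Dirichlet integral,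
    which is finite by the square integrability of the gradients
    ([weak_solution_integrable]). The set Omega enters only through its
    measurability for the sigma-algebra generated by the coordinates
    ([open_measurable_rV]). *)

(** An open set is the union of the cubes contained in it that have a rational
    center and a half side of the form 1/(n+1); there are countably many of
    them. *)
Lemma open_measurable_rV (R : realType) (N : nat) (A : set 'rV[R]_N) :
  open A -> measurable A.
Proof.
move=> oA.
pose ratrV (q : 'rV[rat]_N) : 'rV[R]_N := map_mx ratr q.
pose B (p : 'rV[rat]_N * nat) : set 'rV[R]_N :=
  [set x | forall i, ball ((ratrV p.1) ord0 i) p.2.+1%:R^-1 (x ord0 i)].
have mB p : measurable (B p).
  (* a cube is a finite intersection of preimages under coordinates *)
  rewrite (_ : B p = \big[setI/setT]_(i < N)
    ((fun x : 'rV[R]_N => x ord0 i) @^-1`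
      ball ((ratrV p.1) ord0 i) p.2.+1%:R^-1)); last first.
    apply/seteqP; split => x; rewrite -bigcap_seq => Bx.
      by move=> i _; exact: Bx.
    by move=> i; apply: Bx; rewrite /= mem_index_enum.
  apply: bigsetI_measurable => i _; rewrite -[X in measurable X]setTI.
  by apply: measurable_coor => //; exact: measurable_ball.
rewrite (_ : A = \bigcup_p (if `[< B p `<=` A >] then B p else set0)).
  apply: (@countable_bigcupT_measurable _ _ _ _ (countableP _)).
  by move=> p; case: ifPn.
apply/seteqP; split => [x Ax|x [p _]]; last by case: ifPn => // /asboolP; apply.
have /nbhs_ballP[e /= e0 xeA] : nbhs x A by exact: open_nbhs_nbhs.
have [n ne] : exists n, n.+1%:R^-1 < e / 2.
  have /ltr_add_invr[n] : 0 < e / 2 by rewrite divr_gt0.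
  by rewrite add0r => ne; exists n.
have n0 : 0 < n.+1%:R^-1 :> R by rewrite invr_gt0.
(* a rational point q within 1/(n+1) of x, coordinate by coordinate *)
have /choice[q qx] : forall i : 'I_N, exists r : rat,
    ball (ratr r : R) n.+1%:R^-1 (x ord0 i).
  move=> i.
  have /rat_in_itvoo[r] : x ord0 i < x ord0 i + n.+1%:R^-1 by rewrite ltrDl.
  rewrite in_itv/= => /andP[xr rx]; exists r.
  by rewrite /ball/= gtr0_norm ?subr_gt0// ltrBlDl.
exists (\row_i q i, n) => //.
have Bx : B (\row_i q i, n) x by move=> i; rewrite /ratrV !mxE; exact: qx.
case: ifPn => // /asboolP; apply: contra_notP => _ y By; apply: xeA.
split => // j i; rewrite ord1.
rewrite (splitr e); apply: (@ball_triangle _ _ (ratr (q i) : R)).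
  by apply: ball_sym; apply: le_ball (qx i); exact: ltW.
by move: (By i); rewrite /ratrV !mxE; apply: le_ball; exact: ltW.
Qed.

Section integration.
Context {d : measure_display} {T : measurableType d} {R : realType}.
Variable mu : {measure set T -> \bar R}.
Variable D : set T.
Hypothesis mD : measurable D.
Implicit Types f g : T -> R.

Lemma sqr_integrable_mul f g :
  measurable_fun D f -> measurable_fun D g ->
  (\int[mu]_(x in D) ((f x) ^+ 2)%:E < +oo)%E ->
  (\int[mu]_(x in D) ((g x) ^+ 2)%:E < +oo)%E ->
  mu.-integrable D (fun x => (f x * g x)%:E).
Proof.
move=> mf mg foo goo.
have isqr (h : T -> R) : measurable_fun D h -> (\int[mu]_(x in D) ((h x) ^+ 2)%:E < +oo)%E ->
    mu.-integrable D (fun x => ((h x) ^+ 2)%:E).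
  move=> mh hoo; apply/integrableP; split.
    by apply/measurable_EFinP; exact: measurable_funX.
  apply: le_lt_trans hoo; rewrite le_eqVlt; apply/orP; left; apply/eqP.
  by apply: eq_integral => x _; rewrite gee0_abs// lee_fin sqr_ge0.
apply: (@le_integrable _ _ _ _ _ mD _ (fun x => ((f x) ^+ 2)%:E + ((g x) ^+ 2)%:E)%E).
- by apply/measurable_EFinP; exact: measurable_funM.
- move=> x _; rewrite -EFinD /= lee_fin normrM.
  rewrite [leRHS]ger0_norm ?addr_ge0 ?sqr_ge0//.
  rewrite -(real_normK (num_real (f x))) -(real_normK (num_real (g x))).
  by have := normr_ge0 (f x); have := normr_ge0 (g x); nra.
- by apply: integrableD => //; exact: isqr.
Qed.

Lemma ae_ge0_integrable f : measurable_fun D f ->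
  {ae mu, forall x, D x -> 0 <= f x} ->
  (\int[mu]_(x in D) (f x)%:E < +oo)%E ->
  mu.-integrable D (EFin \o f).
Proof.
move=> mf f0 foo; apply/integrableP; split; first exact/measurable_EFinP.
apply: le_lt_trans foo; rewrite le_eqVlt; apply/orP; left; apply/eqP.
apply: ae_eq_integral => //.
- by apply: measurableT_comp => //; exact/measurable_EFinP.
- exact/measurable_EFinP.
- by apply: filterS f0 => x f0 Dx /=; rewrite ger0_norm// f0.
Qed.

(** A function which is nonpositive almost everywhere has a nonpositive
    integral; if the integral is also nonnegative, the function vanishes almost
    everywhere. *)
Lemma ae_le0_integral_ge0 f : mu.-integrable D (EFin \o f) ->
  {ae mu, forall x, D x -> f x <= 0} ->
  (0 <= \int[mu]_(x in D) (f x)%:E)%E ->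
  {ae mu, forall x, D x -> f x = 0}.
Proof.
move=> intf f0 If; have mf := measurable_int _ intf.
have /(ae_eq_integral_abs _ mD mf) : (\int[mu]_(x in D) `|(EFin \o f) x| = 0)%E.
  apply/eqP; rewrite eq_le integral_ge0 ?andbT//.
  rewrite (@ae_eq_integral _ _ _ _ _ (fun x => - (EFin \o f) x)%E)//.
  - rewrite integralN; first by rewrite oppe_le0.
    exact: integrable_add_def.
  - exact: measurableT_comp.
  - exact: measurableT_comp.
  - by apply: filterS f0 => x f0 Dx /=; rewrite ler0_norm// f0.
by apply: filterS => x + Dx => /(_ Dx)[].
Qed.

(** The shape of the integrand is that of the expansion of
    (s - t) * (s' - t'). *)
Lemma integral_second_difference (a b c e : T -> R) :
  mu.-integrable D (EFin \o a) -> mu.-integrable D (EFin \o b) ->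
  mu.-integrable D (EFin \o c) -> mu.-integrable D (EFin \o e) ->
  (\int[mu]_(x in D) ((a x - b x) - (c x - e x))%:E =
   (\int[mu]_(x in D) (a x)%:E - \int[mu]_(x in D) (b x)%:E) -
   (\int[mu]_(x in D) (c x)%:E - \int[mu]_(x in D) (e x)%:E))%E.
Proof.
move=> ia ib ic ie; rewrite -!integralB_EFin//.
- exact: (integrableB mD ia ib).
- exact: (integrableB mD ic ie).
Qed.

Lemma integrable_second_difference (a b c e : T -> R) :
  mu.-integrable D (EFin \o a) -> mu.-integrable D (EFin \o b) ->
  mu.-integrable D (EFin \o c) -> mu.-integrable D (EFin \o e) ->
  mu.-integrable D (EFin \o (fun x => (a x - b x) - (c x - e x))).
Proof.
move=> ia ib ic ie.
exact: (integrableB mD (integrableB mD ia ib) (integrableB mD ic ie)).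
Qed.

End integration.

(** Strict monotonicity of the nonlinearity, with its equality case. *)
Lemma powRN_sub_mul_sub (R : realType) (alpha s t : R) :
  0 < alpha -> 0 < s -> 0 < t ->
  (s `^ (- alpha) - t `^ (- alpha)) * (s - t) <= 0 ?= iff (s == t).
Proof.
move=> a0.
have anti x y : 0 < x -> x < y -> y `^ (- alpha) < x `^ (- alpha).
  move=> x0 xy; have y0 := lt_trans x0 xy.
  rewrite !powRN ltf_pV2 ?posrE ?powR_gt0//.
  by apply: gt0_ltr_powR => //; rewrite nnegrE ltW.
move=> s0 t0; apply/leifP; case: (ltgtP s t) => [st|ts|->]; last by rewrite subrr mul0r.
- by rewrite nmulr_llt0 ?subr_lt0// subr_gt0 anti.
- by rewrite pmulr_llt0 ?subr_gt0// subr_lt0 anti.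
Qed.

Section ae_in.
Context {R : realType} {N : nat} (Omega : set 'rV[R]_N).
Implicit Types P Q S : 'rV[R]_N -> Prop.

Lemma ae_inS P Q : (forall x, Omega x -> P x -> Q x) ->
  ae_in Omega P -> ae_in Omega Q.
Proof.
by rewrite /ae_in => PQ; apply: filterS => x OP Ox; apply: PQ => //; exact: OP.
Qed.

Lemma ae_inS2 P Q S : (forall x, Omega x -> P x -> Q x -> S x) ->
  ae_in Omega P -> ae_in Omega Q -> ae_in Omega S.
Proof.
rewrite /ae_in => PQS; apply: filterS2 => x OP OQ Ox.
by apply: PQS => //; [exact: OP|exact: OQ].
Qed.

End ae_in.

Section dirichlet.
Context {R : realType} {N : nat} (Omega : set 'rV[R]_N).
Hypothesis oO : open Omega.

Let mu := @lebesgue_rV R N.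

Lemma H10_grad u : H10 Omega u -> H10_gradient Omega u (grad Omega u).
Proof. by move=> hu; exact: (xgetPex (fun=> 0) hu). Qed.

Lemma H10_measurable u : H10 Omega u -> measurable_fun Omega u.
Proof. by move=> [g [[[]]]]. Qed.

Lemma integrable_grad_mul u v : H10 Omega u -> H10 Omega v ->
  mu.-integrable Omega
    (fun x => (\sum_(i < N) grad Omega u x ord0 i * grad Omega v x ord0 i)%:E).
Proof.
move=> /H10_grad[[_ gu _] _] /H10_grad[[_ gv _] _].
have mO := open_measurable_rV oO.
under eq_fun do rewrite -sumEFin.
apply: integrable_sum => // i _.
have [mfu u2] := gu i; have [mfv v2] := gv i.
exact: (sqr_integrable_mul mO mfu mfv u2 v2).
Qed.

Lemma dirichlet_form_fin u v : H10 Omega u -> H10 Omega v ->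
  dirichlet_form Omega u v \is a fin_num.
Proof.
move=> hu hv; apply: integrable_fin_num; first exact: open_measurable_rV.
exact: integrable_grad_mul.
Qed.

(** The expression is the integral of |grad u - grad v|^2, where grad u and
    grad v are the chosen gradients of u and of v; whether their difference is
    the chosen gradient of u - v plays no role. *)
Lemma dirichlet_form_second_difference_ge0 u v : H10 Omega u -> H10 Omega v ->
  (0 <= (dirichlet_form Omega u u - dirichlet_form Omega u v) -
        (dirichlet_form Omega v u - dirichlet_form Omega v v))%E.
Proof.
move=> hu hv; rewrite /dirichlet_form -integral_second_difference.
- apply: integral_ge0 => x _; rewrite lee_fin -!sumrB sumr_ge0// => i _.
  set a := grad _ u x ord0 i; set b := grad _ v x ord0 i.
  by rewrite (_ : _ - _ = (a - b) ^+ 2) ?sqr_ge0//; ring.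
- exact: open_measurable_rV.
- exact: integrable_grad_mul.
- exact: integrable_grad_mul.
- exact: integrable_grad_mul.
- exact: integrable_grad_mul.
Qed.

Lemma measurable_singular alpha u v : H10 Omega u -> H10 Omega v ->
  measurable_fun Omega (fun x => u x `^ (- alpha) * v x).
Proof.
move=> /H10_measurable mfu /H10_measurable mfv; apply: measurable_funM => //.
exact: measurableT_comp (measurable_powR _) mfu.
Qed.

(** For a nonnegative test function the singular integrand is nonnegative, so
    that it is integrable as soon as its integral, a Dirichlet integral by the
    equation, is finite. *)
Lemma weak_solution_integrable alpha u v :
  weak_solution Omega alpha u -> H10 Omega v ->
  ae_in Omega (fun x => 0 <= v x) ->
  mu.-integrable Omega (fun x => (u x `^ (- alpha) * v x)%:E).
Proof.
move=> [hu su] hv v0; apply: ae_ge0_integrable.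
- exact: open_measurable_rV.
- exact: measurable_singular.
- by apply: ae_inS v0 => x _ v0; rewrite mulr_ge0 ?powR_ge0.
- rewrite -[ltLHS]/(singular_term Omega alpha u v) -su//.
  by rewrite ltey_eq dirichlet_form_fin.
Qed.

Lemma positive_weak_solution_unique alpha u v : 0 < alpha ->
  weak_solution Omega alpha u -> weak_solution Omega alpha v ->
  ae_in Omega (fun x => 0 < u x) -> ae_in Omega (fun x => 0 < v x) ->
  ae_in Omega (fun x => u x = v x).
Proof.
move=> a0 su sv u0 v0; have [hu eu] := su; have [hv ev] := sv.
have mO := open_measurable_rV oO.
have u0' : ae_in Omega (fun x => 0 <= u x).
  by apply: ae_inS u0 => x _ /ltW.
have v0' : ae_in Omega (fun x => 0 <= v x).
  by apply: ae_inS v0 => x _ /ltW.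
have iuu := weak_solution_integrable su hu u0'.
have iuv := weak_solution_integrable su hv v0'.
have ivu := weak_solution_integrable sv hu u0'.
have ivv := weak_solution_integrable sv hv v0'.
pose F x := (u x `^ (- alpha) * u x - u x `^ (- alpha) * v x) -
            (v x `^ (- alpha) * u x - v x `^ (- alpha) * v x).
have FE x : F x = (u x `^ (- alpha) - v x `^ (- alpha)) * (u x - v x).
  by rewrite /F; ring.
have F0 : ae_in Omega (fun x => F x = 0).
  apply: (ae_le0_integral_ge0 mO).
  - exact: (integrable_second_difference mO iuu iuv ivu ivv).
  - apply: ae_inS2 u0 v0 => x _ u0 v0; rewrite FE.
    exact: (powRN_sub_mul_sub a0 u0 v0).1.
  - rewrite integral_second_difference//.
    have := dirichlet_form_second_difference_ge0 hu hv.
    by rewrite (eu u)// (eu v)// (ev u)// (ev v).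
have uv x : 0 < u x -> 0 < v x -> F x = 0 -> u x = v x.
  move=> ux0 vx0 Fx0; apply/eqP.
  by rewrite -(powRN_sub_mul_sub a0 ux0 vx0).2 -FE Fx0.
have uv0 : ae_in Omega (fun x => 0 < u x /\ 0 < v x).
  exact: ae_inS2 u0 v0.
by apply: ae_inS2 uv0 F0 => x _ [ux0 vx0]; exact: uv.
Qed.

End dirichlet.

Theorem theorem2p7 (R : realType) (N : nat) (hN : (0 < N)%N)
    (Omega : set 'rV[R]_N) (hOmega : smooth_bounded_domain Omega)
    (alpha : R) (halpha : 0 < alpha < 1)
    (usub usup : 'rV[R]_N -> R)
    (hsub : subsolution Omega alpha usub)
    (hsup : supersolution Omega alpha usup)
    (hle : ae_in Omega (fun x => usub x <= usup x))
    (c1 c2 : R)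
    (hbounds : ae_in Omega (fun x =>
       [/\ 0 < c1 * dist_boundary Omega x,
           c1 * dist_boundary Omega x <= usub x,
           usub x <= usup x &
           usup x <= c2 * dist_boundary Omega x]))
    (u v : 'rV[R]_N -> R)
    (hu : weak_solution Omega alpha u)
    (hv : weak_solution Omega alpha v)
    (hubounds : ae_in Omega (fun x => usub x <= u x /\ u x <= usup x))
    (hvbounds : ae_in Omega (fun x => usub x <= v x /\ v x <= usup x)) :
  ae_in Omega (fun x => u x = v x).
Proof.
have /andP[a0 _] := halpha; have [[_ oO _] _ _] := hOmega.
have pos w : ae_in Omega (fun x => usub x <= w x /\ w x <= usup x) ->
    ae_in Omega (fun x => 0 < w x).
  move=> hw; apply: ae_inS2 hbounds hw => x _ [d0 dx _ _] [lw _].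
  exact: lt_le_trans d0 (le_trans dx lw).
exact: (positive_weak_solution_unique oO a0 hu hv (pos u hubounds) (pos v hvbounds)).
Qed.
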